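(* Let $R$ be a ring and $G$ a group. If the group ring $RG$ is a $W\sqrt{J}U$ ring, then $R$ is also a $W\sqrt{J}U$ ring.
   Context: Rings are associative with identity, not necessarily commutative. For a ring $A$, $U(A)$ is its group of units, $J(A)$ its Jacobson radical, and $\sqrt{J(A)}=\{x\in A : x^n\in J(A)\text{ for some } n\ge 1\}$. A ring $A$ is $W\sqrt{J}U$ (weakly $\sqrt{J}U$) if $U(A)=\pm 1+\sqrt{J(A)}$; equivalently, every unit of $A$ can be written as $j+1$ or as $j-1$ for some $j\in\sqrt{J(A)}$. *)

(* Defs.v *)
From HB Require Import structures.
From mathcomp Require Import all_boot all_order all_algebra finmap.
From mathcomp Require Import boolp classical_sets.
From mathcomp.multinomials Require Import monalg.

Set Implicit Arguments.
Unset Strict Implicit.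
Unset Printing Implicit Defensive.

Import GRing.Theory.

Local Open Scope classical_set_scope.
Local Open Scope ring_scope.

(* Rings are [pzRingType]s: associative, unital, not necessarily commutative,
   the zero ring being allowed. [unitRingType] is avoided since it presupposes
   decidable units, which a group ring does not come with. *)

Section RingNotions.
Variable A : pzRingType.

Definition ring_units : set A :=
  [set u | exists v : A, v * u = 1 /\ u * v = 1].

Definition left_ideal (I : set A) : Prop :=
  [/\ I 0,
      forall x y, I x -> I y -> I (x + y)
    & forall a x, I x -> I (a * x)].

Definition maximal_left_ideal (M : set A) : Prop :=
  [/\ left_ideal M, M <> setT
    & forall I : set A, left_ideal I -> M `<=` I -> I = M \/ I = setT].

(* In the zero ring there is no maximal left ideal and this is the whole
   ring. *)
Definition jacobson_radical : set A :=
  [set x | forall M : set A, maximal_left_ideal M -> M x].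

Definition sqrt_jacobson : set A :=
  [set x | exists2 n : nat, (1 <= n)%N & jacobson_radical (x ^+ n)].

Definition weakly_sqrtJU : Prop :=
  ring_units =
  [set u | exists2 j : A, sqrt_jacobson j & u = 1 + j \/ u = - 1 + j].

End RingNotions.

(* The additive group of finitely supported functions G -> R is {malg R[G]}.
   The product that [monalg] puts on it requires a [monomType], in which 1 is
   the only invertible element, so the convolution product is redone here on an
   alias, for an arbitrary, possibly infinite, group. *)
Definition group_ring (R : pzRingType) (G : groupType) : Type := {malg R[G]}.

HB.instance Definition _ (R : pzRingType) (G : groupType) :=
  GRing.Zmodule.copy (group_ring R G) {malg R[G]}.

Section GroupRing.
Variables (R : pzRingType) (G : groupType).
Local Open Scope fset_scope.

Implicit Types (f g : {malg R[G]}) (x y : G).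

Definition gr_one : {malg R[G]} := << 1 *g 1%g >>.

Definition gr_mul f g : {malg R[G]} :=
  \sum_(x <- msupp f) \sum_(y <- msupp g) << f@_x * g@_y *g (x * y)%g >>.

Lemma gr_mulw (d1 d2 : {fset G}) f g :
  msupp f `<=` d1 -> msupp g `<=` d2 ->
  gr_mul f g = \sum_(x <- d1) \sum_(y <- d2) << f@_x * g@_y *g (x * y)%g >>.
Proof.
move=> le_d1 le_d2; rewrite /gr_mul (big_fset_incl _ le_d1) /=.
  apply/eq_bigr=> x _; apply/big_fset_incl => // y _ /mcoeff_outdom ->.
  by rewrite mulr0 monalgU0.
move=> x _ /mcoeff_outdom fx.
by rewrite big1 => // y _; rewrite fx mul0r monalgU0.
Qed.

Lemma gr_mulUU (a b : R) x y :
  gr_mul << a *g x >> << b *g y >> = << a * b *g (x * y)%g >>.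
Proof. by rewrite (gr_mulw msuppU_le msuppU_le) !big_seq_fset1 !mcoeffUU. Qed.

Lemma gr_mul1g : left_id gr_one gr_mul.
Proof.
move=> g; rewrite (gr_mulw msuppU_le (fsubset_refl _)) big_seq_fset1.
rewrite [RHS]monalgE; apply/eq_bigr=> y _.
by rewrite mcoeffUU mul1r mul1g.
Qed.

Lemma gr_mulg1 : right_id gr_one gr_mul.
Proof.
move=> f; rewrite (gr_mulw (fsubset_refl _) msuppU_le) [RHS]monalgE.
by apply/eq_bigr=> x _; rewrite big_seq_fset1 mcoeffUU mulr1 mulg1.
Qed.

Lemma gr_mulDl : left_distributive gr_mul +%R.
Proof.
move=> f1 f2 g.
rewrite (gr_mulw (msuppD_le _ _) (fsubset_refl _)).
rewrite (gr_mulw (fsubsetUl _ (msupp f2)) (fsubset_refl (msupp g))).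
rewrite (gr_mulw (fsubsetUr (msupp f1) _) (fsubset_refl (msupp g))).
rewrite -big_split /=; apply/eq_bigr=> x _.
rewrite -big_split /=; apply/eq_bigr=> y _.
by rewrite mcoeffD mulrDl monalgUD.
Qed.

Lemma gr_mulDr : right_distributive gr_mul +%R.
Proof.
move=> f g1 g2.
rewrite (gr_mulw (fsubset_refl _) (msuppD_le _ _)).
rewrite (gr_mulw (fsubset_refl (msupp f)) (fsubsetUl _ (msupp g2))).
rewrite (gr_mulw (fsubset_refl (msupp f)) (fsubsetUr (msupp g1) _)).
rewrite -big_split /=; apply/eq_bigr=> x _.
rewrite -big_split /=; apply/eq_bigr=> y _.
by rewrite mcoeffD mulrDr monalgUD.
Qed.

Lemma gr_mul0g : left_zero 0 gr_mul.
Proof. by move=> g; rewrite /gr_mul msupp0 big_seq_fset0. Qed.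

Lemma gr_mulg0 : right_zero 0 gr_mul.
Proof.
by move=> f; rewrite /gr_mul big1 // => x _; rewrite msupp0 big_seq_fset0.
Qed.

Lemma gr_mul_suml (I : Type) (r : seq I) (F : I -> {malg R[G]}) g :
  gr_mul (\sum_(i <- r) F i) g = \sum_(i <- r) gr_mul (F i) g.
Proof.
exact: (big_morph (gr_mul^~ g) (fun _ _ => gr_mulDl _ _ _) (gr_mul0g _)).
Qed.

Lemma gr_mul_sumr (I : Type) (r : seq I) f (F : I -> {malg R[G]}) :
  gr_mul f (\sum_(i <- r) F i) = \sum_(i <- r) gr_mul f (F i).
Proof. exact: (big_morph (gr_mul f) (fun _ _ => gr_mulDr _ _ _) (gr_mulg0 _)). Qed.

Lemma gr_mulA : associative gr_mul.
Proof.
move=> f g h; rewrite [f]monalgE !gr_mul_suml; apply/eq_bigr=> x _.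
rewrite [g]monalgE gr_mul_suml !gr_mul_sumr gr_mul_suml.
apply/eq_bigr=> y _; rewrite [h]monalgE !gr_mul_sumr.
by apply/eq_bigr=> z _; rewrite !gr_mulUU mulrA mulgA.
Qed.

HB.instance Definition _ := GRing.Zmodule_isPzRing.Build (group_ring R G)
  gr_mulA gr_mul1g gr_mulg1 gr_mulDl gr_mulDr.

End GroupRing.

(* Main.v *)
Require Import Defs.
From mathcomp Require Import all_boot all_algebra.
From HB Require Import structures.
From mathcomp Require Import boolp classical_sets.
From mathcomp.multinomials Require Import monalg.

(** The inclusion [1 + j, - 1 + j \in U(A)] for [j] in the radical's root holds
    in every ring: if [j ^+ n] lies in the Jacobson radical then [j ^+ n - 1] is
    a unit, and [j - 1] is a factor of it commuting with its cofactor
    ([sqrtJ_sub1_unit]); the sign is changed by passing from [j] to [- j].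

    The content is therefore the other inclusion, and it descends along any ring
    morphism [iota : R -> A] admitting a retraction [pi : A -> R] that is linear
    for the right action of [R] ([weakly_sqrtJU_descent]). A unit [u] of [R]
    yields the unit [iota u = +-1 + j], so [j = iota (u -+ 1)], and what has to be
    seen is that [iota x \in J(A)] forces [x \in J(R)]. By [jacobsonP], membership
    of [x] in the radical means that every [1 + a * x] has a left inverse; a left
    inverse of [iota (1 + a * x)] is sent by [pi] to a left inverse of
    [1 + a * x].

    For the group ring, [iota] embeds [R] as the multiples of the neutral element
    of [G], and [pi] reads off the coefficient at that element. *)

Set Implicit Arguments.
Unset Strict Implicit.
Unset Printing Implicit Defensive.

Import GRing.Theory.

Local Open Scope classical_set_scope.
Local Open Scope ring_scope.

Section Jacobson.
Variable A : pzRingType.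
Implicit Types (a x y z : A) (L M : set A).

Lemma left_ideal_setT M : left_ideal M -> M 1 -> M = setT.
Proof.
by case=> _ _ MM M1; apply/seteqP; split=> // x _; rewrite -[x]mulr1; apply: MM.
Qed.

Lemma left_ideal_principal z : left_ideal [set y | exists a, y = a * z].
Proof.
split=> [|_ _ [a ->] [b ->]|b _ [a ->]]; first by exists 0; rewrite mul0r.
  by exists (a + b); rewrite mulrDl.
by exists (b * a); rewrite mulrA.
Qed.

(** Zorn's lemma is applied to the sets [X] such that [L `|` X] is a proper left
    ideal, and not to the proper left ideals above [L]: the union of the empty
    chain then causes no exception. *)
Lemma proper_left_ideal_sub_maximal L :
  left_ideal L -> ~ L 1 -> exists2 M, maximal_left_ideal M & L `<=` M.
Proof.
move=> idL L1.
pose P X := left_ideal (L `|` X) /\ ~ (L `|` X) 1.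
have [F FP Ftot|X [[idX X1] Xmax]] := @Zorn_bigcup A P.
  case: (idL) => L0 LD LM; split; last first.
    by case=> // -[X FX X1]; case: (FP _ FX) => _; apply; right.
  split; first by left.
    have common x y X : F X -> (L `|` X) x -> (L `|` X) y ->
        (L `|` \bigcup_(Y in F) Y) (x + y).
      move=> FX Xx Xy; case: (FP _ FX) => -[_ XD _] _.
      by case: (XD _ _ Xx Xy) => [|Xxy]; [left | right; exists X].
    move=> x y [Lx|[X FX Xx]] [Ly|[Y FY Yy]].
    - by left; apply: LD.
    - by apply: (common _ _ Y FY); [left | right].
    - by apply: (common _ _ X FX); [right | left].
    - case: (Ftot _ _ FX FY) => sub.
        by apply: (common _ _ Y FY); right => //; apply: sub.
      by apply: (common _ _ X FX); right => //; apply: sub.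
  move=> a x [Lx|[X FX Xx]]; first by left; apply: LM.
  case: (FP _ FX) => -[_ _ XM] _.
  by case: (XM a x); [right | left | right; exists X].
exists (L `|` X); last by move=> x; left.
split=> // [eT|I idI LXI]; first by apply: X1; rewrite eT.
have [I1|I1] := pselect (I 1); first by right; apply: left_ideal_setT.
have LI : L `|` I = I by apply/setUidr => x Lx; apply: LXI; left.
left; apply/seteqP; split=> // x Ix; apply: contrapT => nLXx.
apply: (Xmax I); last by rewrite /P LI.
by split=> [y Xy|IX]; [apply: LXI; right | apply: nLXx; right; apply: IX].
Qed.

Lemma jacobson_mul a x : jacobson_radical x -> jacobson_radical (a * x).
Proof. by move=> Jx M maxM; have [[_ _ MM] _ _] := maxM; exact/MM/(Jx M). Qed.

Lemma jacobson_left_inverse x :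
  jacobson_radical x -> exists c, c * (1 + x) = 1.
Proof.
move=> Jx; apply: contrapT => no_inv.
have [|M maxM subM] :=
    proper_left_ideal_sub_maximal (left_ideal_principal (1 + x)).
  by case=> c e; apply: no_inv; exists c.
have [[_ MD MM] MnT _] := maxM.
apply/MnT/left_ideal_setT; first by case: maxM.
have M1x : M (1 + x) by apply: subM; exists 1; rewrite mul1r.
have := MD _ _ M1x (MM (-1) x (Jx M maxM)).
by rewrite mulN1r addrK.
Qed.

(** The radical is defined through maximal left ideals; this form of it is an
    existence statement about elements, which maps between rings can carry. *)
Lemma jacobsonP x :
  jacobson_radical x <-> forall a, exists c, c * (1 + a * x) = 1.
Proof.
split=> [Jx a|inv M maxM].
  exact: (jacobson_left_inverse (jacobson_mul a Jx)).
have [idM MnT Mmax] := maxM; have [M0 MD MM] := idM.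
apply: contrapT => nMx.
(* the left ideal [M + A x] is strictly above [M], hence contains 1 *)
pose I : set A := [set y | exists m a, M m /\ y = m + a * x].
have idI : left_ideal I.
  split=> [|_ _ [m [a [Mm ->]]] [n [b [Mn ->]]]|b _ [m [a [Mm ->]]]].
  - by exists 0, 0; rewrite mul0r addr0.
  - by exists (m + n), (a + b); split; [apply: MD | rewrite mulrDl addrACA].
  - by exists (b * m), (b * a); split; [apply: MM | rewrite mulrDr mulrA].
have Ix : I x by exists 0, 1; rewrite mul1r add0r.
case: (Mmax I idI) => [m Mm|IM|IT]; first by exists m, 0; rewrite mul0r addr0.
  by apply: nMx; rewrite -IM.
have [m [a [Mm e]]] : I 1 by rewrite IT.
have [c ce] := inv (- a).
apply/MnT/left_ideal_setT => //; rewrite -ce; apply: MM.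
by rewrite e mulNr addrK.
Qed.

Lemma ring_unitsN x : ring_units x -> ring_units (- x).
Proof. by case=> v [vx xv]; exists (- v); rewrite !mulrNN. Qed.

(** A left inverse [c] of [1 + x] equals [1 - c * x], so it is itself of the form
    one plus a radical element and has a left inverse, which can only be
    [1 + x]. *)
Lemma jacobson_add1_unit x : jacobson_radical x -> ring_units (1 + x).
Proof.
move=> Jx; have [c cx] := jacobson_left_inverse Jx.
have [d] := jacobson_left_inverse (jacobson_mul (- c) Jx).
have -> : 1 + - c * x = c by rewrite -{1}cx mulrDr mulr1 mulNr addrK.
move=> dc; exists c; split=> //.
by have := mulrA d c (1 + x); rewrite cx dc mulr1 mul1r => <-.
Qed.

Lemma ring_units_factor x y :
  x * y = y * x -> ring_units (x * y) -> ring_units x.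
Proof.
move=> xy [w [wxy xyw]]; have left_inv : w * y * x = 1 by rewrite -mulrA -xy.
exists (w * y); split=> //.
have -> : w * y = y * w.
  by rewrite -[RHS]mul1r -left_inv -!mulrA [x * _]mulrA xyw mulr1.
by rewrite mulrA.
Qed.

Lemma sqrtJN x : sqrt_jacobson x -> sqrt_jacobson (- x).
Proof.
by case=> n n_gt0 Jx; exists n => //; rewrite exprNn; apply: jacobson_mul.
Qed.

Lemma sqrtJ_sub1_unit x : sqrt_jacobson x -> ring_units (x - 1).
Proof.
case=> n _ Jx; pose S := \sum_(i < n) x ^+ i.
have comS : (x - 1) * S = S * (x - 1).
  apply: commr_sum => i _; apply/commr_sym/commrB; last exact: commr1.
  exact/commr_sym/commrX.
apply: (ring_units_factor comS); rewrite -subrX1 -opprB.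
apply: ring_unitsN; apply: jacobson_add1_unit.
by rewrite -mulN1r; apply: jacobson_mul.
Qed.

Lemma sqrtJ_add1_unit x : sqrt_jacobson x -> ring_units (1 + x).
Proof.
by move=> /sqrtJN/sqrtJ_sub1_unit/ring_unitsN; rewrite opprB opprK.
Qed.

Lemma weakly_sqrtJU_of_units :
  (forall u : A, ring_units u ->
    exists2 j, sqrt_jacobson j & u = 1 + j \/ u = - 1 + j) ->
  weakly_sqrtJU A.
Proof.
move=> unitsP; apply/seteqP; split=> [u /unitsP //|_ [j Jj [->|->]]].
  exact: sqrtJ_add1_unit.
by rewrite addrC; apply: sqrtJ_sub1_unit.
Qed.

End Jacobson.

Section Descent.
Variables (R A : pzRingType) (iota : {rmorphism R -> A}) (pi : A -> R).
Hypothesis pi1 : pi 1 = 1.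
Hypothesis pi_linear : forall c r, pi (c * iota r) = pi c * r.

Lemma rmorph_ring_units u : ring_units u -> ring_units (iota u).
Proof.
by case=> v [vu uv]; exists (iota v); rewrite -!rmorphM vu uv rmorph1.
Qed.

(** A left inverse in [A] of an element [iota r] is turned by [pi] into a left
    inverse of [r] in [R]. *)
Lemma jacobson_descent x : jacobson_radical (iota x) -> jacobson_radical x.
Proof.
move=> /jacobsonP inv; apply/jacobsonP => a; have [c ce] := inv (iota a).
by exists (pi c); rewrite -pi_linear rmorphD rmorphM rmorph1 ce.
Qed.

Lemma sqrtJ_descent x : sqrt_jacobson (iota x) -> sqrt_jacobson x.
Proof.
by case=> n n_gt0; rewrite -rmorphXn => /jacobson_descent Jx; exists n.
Qed.

Lemma weakly_sqrtJU_descent : weakly_sqrtJU A -> weakly_sqrtJU R.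
Proof.
move=> wA; apply: weakly_sqrtJU_of_units => u /rmorph_ring_units.
rewrite wA => -[j Jj [e|e]].
  exists (u - 1); last by left; rewrite addrC subrK.
  by apply: sqrtJ_descent; rewrite rmorphB rmorph1 e addrC addKr.
exists (u + 1); last by right; rewrite addrC addrK.
by apply: sqrtJ_descent; rewrite rmorphD rmorph1 e addrC addNKr.
Qed.

End Descent.

Section GroupRingRetraction.
Variables (R : pzRingType) (G : groupType).

Definition gr_const (r : R) : group_ring R G := << r *g 1%g >>.

Lemma gr_const_is_zmod_morphism : zmod_morphism gr_const.
Proof. exact: monalgUB. Qed.

Lemma gr_const_is_monoid_morphism : monoid_morphism gr_const.
Proof.
by split=> // r s; rewrite /gr_const -[RHS]/(gr_mul _ _) gr_mulUU mulg1.
Qed.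

HB.instance Definition _ :=
  GRing.isZmodMorphism.Build R (group_ring R G) gr_const
    gr_const_is_zmod_morphism.
HB.instance Definition _ :=
  GRing.isMonoidMorphism.Build R (group_ring R G) gr_const
    gr_const_is_monoid_morphism.

Definition gr_coef1 (f : group_ring R G) : R := (f : {malg R[G]})@_(1%g).

Lemma gr_coef1_1 : gr_coef1 1 = 1.
Proof. exact: mcoeffUU. Qed.

Lemma gr_coef1_mulr (f : group_ring R G) r :
  gr_coef1 (f * gr_const r) = gr_coef1 f * r.
Proof.
rewrite /gr_coef1 -[f * _]/(gr_mul f << r *g 1%g >>).
rewrite [f]monalgE gr_mul_suml !raddf_sum mulr_suml; apply: eq_bigr => x _ /=.
by rewrite gr_mulUU mulg1 !mcoeffU mulrnAl.
Qed.

End GroupRingRetraction.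

Theorem lemma3p1 (R : pzRingType) (G : groupType) :
  weakly_sqrtJU (group_ring R G) -> weakly_sqrtJU R.
Proof.
exact: (weakly_sqrtJU_descent (gr_coef1_1 R G) (@gr_coef1_mulr R G)).
Qed.
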